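(* Let $K\in\mathbb{N}_0$, let $S=(S_t)_{0\le t\le K}$ be a strictly positive adapted process, and let $\psi=(\psi_0,\ldots,\psi_K)$ be a positively homogeneous projection property. Let $X=X(S,\psi)$ be the regular consumption process with the property $\psi$, and suppose its corresponding relative consumption rates $Z=Z(S,\psi)$ are deterministic, $$Z_k\equiv z_k,\quad k=0,\ldots,K,$$ where $z_k\in[0,1)$ for $k=0,\ldots,K-1$ and $z_K\in[0,1]$. Let $k_0$ be the maximal $k\in\{0,\ldots,K\}$ such that $z_k=0$ (and put $k_0=0$ if there is no such $k$). Then $$\psi_k(S_{k+1}/S_k)\equiv\frac{z_k}{(1-z_k)z_{k+1}},\quad k=k_0,\ldots,K-1,$$ and $$\psi_K\equiv z_K .$$
   Context: Let $(\Omega,\mathcal{F},\mathbb{P})$ be a probability space with a filtration $(\mathcal{F}_t)_{0\le t\le K}$, $K\in\mathbb{N}_0$. $S=(S_t)_{0\le t\le K}$ is a strictly positive real-valued process adapted to $(\mathcal{F}_t)$ (money account without consumption). A consumption process is a real-valued process $X=(X_k)_{k=0,\ldots,K}$ adapted to $(\mathcal{F}_k)_{k=0,\ldots,K}$. The money account with consumption $A=(A_t)_{0\le t\le K}$ associated with $S$ and $X$ is defined by $A_0=S_0$ and $A_t=(A_k-X_k)S_t/S_k$ for $k<t\le k+1$, $k=0,\ldots,K-1$. $X$ is called regular with respect to $S$ if $0\le X_k\le A_k$ for $k=0,\ldots,K$. Equalities and inequalities between random variables are understood pointwise; $\equiv$ means equality to a constant. $L^0(\mathcal{F}_k)$ denotes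 the set of real-valued $\mathcal{F}_k$-measurable random variables, and $L^0_+(\mathcal{F}_k)$, $L^0_-(\mathcal{F}_k)$ the subsets of non-negative, respectively non-positive, ones. A positively homogeneous projection property (PHPP) is a tuple $\psi=(\psi_0,\ldots,\psi_K)$ such that: for $k=0,\ldots,K-1$, $\psi_k$ is a mapping $L^0(\mathcal{F}_{k+1})\to L^0(\mathcal{F}_k)$ (not necessarily linear) which maps $L^0_+(\mathcal{F}_{k+1})$ into $L^0_+(\mathcal{F}_k)$ and $L^0_-(\mathcal{F}_{k+1})$ into $L^0_-(\mathcal{F}_k)$ and satisfies $\psi_k(YX)=Y\psi_k(X)$ for all $X\in L^0(\mathcal{F}_{k+1})$, $Y\in L^0_+(\mathcal{F}_k)$; and $\psi_K\in L^0_+(\mathcal{F}_K)$ is a random variable with $\psi_K\le 1$. A consumption process $X$ has the PHPP $\psi$ if $X_k=\psi_k(X_{k+1})$ for $k=0,\ldots,K-1$ and $X_K=\psi_KA_K$. There is exactly one non-negative consumption process with the PHPP $\psi$; it is regular and denoted $X(S,\psi)$. It is given by $X_k=Z_kA_k$, $k=0,\ldots,K$, where the relative consumption rates $Z=Z(S,\psi)$ are defined by $Z_K=\psi_K$ and $Z_{k-1}=\psi_{k-1}(Z_kS_k)/(S_{k-1}+\psi_{k-1}(Z_kS_k))$, $k=1,\ldots,K$. *)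

(* Defs.v *)
From HB Require Import structures.
From mathcomp Require Import all_boot all_order all_algebra.
From mathcomp Require Import all_classical all_reals all_analysis.

Set Implicit Arguments.
Unset Strict Implicit.
Unset Printing Implicit Defensive.

Import Order.TTheory GRing.Theory Num.Theory.

Local Open Scope classical_set_scope.
Local Open Scope ring_scope.

(* Processes and filtrations are total functions of the time; only the times
   in [0, K] (resp. the integer times 0, ..., K) are meaningful.  Likewise a
   map L^0(F_(k+1)) -> L^0(F_k) is a total function on T -> R whose values
   outside of L^0(F_(k+1)) are never constrained nor used. *)

Definition filtration d (T : measurableType d) (R : realType) (K : nat)
    (F : R -> set (set T)) : Prop :=
  [/\ forall t : R, 0 <= t <= K%:R -> sigma_algebra setT (F t),
      forall t : R, 0 <= t <= K%:R -> F t `<=` measurable &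
      forall s t : R, 0 <= s -> s <= t -> t <= K%:R -> F s `<=` F t].

(* When G is a sigma-algebra, the measurable sets of g_sigma_algebraType G are
   exactly the elements of G. *)
Definition L0 d (T : measurableType d) (R : realType) (G : set (set T)) :
    set (T -> R) :=
  [set f | measurable_fun (setT : set (g_sigma_algebraType G)) f].

Definition L0_nneg d (T : measurableType d) (R : realType)
    (G : set (set T)) : set (T -> R) :=
  [set f | L0 G f /\ forall w, 0 <= f w].

Definition L0_npos d (T : measurableType d) (R : realType)
    (G : set (set T)) : set (T -> R) :=
  [set f | L0 G f /\ forall w, f w <= 0].

Definition adapted d (T : measurableType d) (R : realType) (K : nat)
    (F : R -> set (set T)) (S : R -> T -> R) : Prop :=
  forall t : R, 0 <= t <= K%:R -> L0 (F t) (S t).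

Definition consumption_process d (T : measurableType d) (R : realType)
    (K : nat) (F : R -> set (set T)) (X : nat -> T -> R) : Prop :=
  forall k, (k <= K)%N -> L0 (F k%:R) (X k).

(* A is the money account with consumption associated with S and X. *)
Definition money_account d (T : measurableType d) (R : realType) (K : nat)
    (S : R -> T -> R) (X : nat -> T -> R) (A : R -> T -> R) : Prop :=
  (forall w, A 0 w = S 0 w) /\
  forall (k : nat) (t : R), (k < K)%N -> k%:R < t <= k.+1%:R ->
    forall w, A t w = (A k%:R w - X k w) * S t w / S k%:R w.

Definition regular d (T : measurableType d) (R : realType) (K : nat)
    (X : nat -> T -> R) (A : R -> T -> R) : Prop :=
  forall k, (k <= K)%N -> forall w, 0 <= X k w <= A k%:R w.

(* The tuple (psi_0, ..., psi_K) is split into the maps psi k, k < K, and the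
   random variable psiK. *)
Record phpp d (T : measurableType d) (R : realType) (K : nat)
    (F : R -> set (set T)) (psi : nat -> (T -> R) -> (T -> R))
    (psiK : T -> R) : Prop := Phpp {
  phpp_L0 : forall k, (k < K)%N ->
    forall X, L0 (F k.+1%:R) X -> L0 (F k%:R) (psi k X);
  phpp_nneg : forall k, (k < K)%N ->
    forall X, L0_nneg (F k.+1%:R) X -> L0_nneg (F k%:R) (psi k X);
  phpp_npos : forall k, (k < K)%N ->
    forall X, L0_npos (F k.+1%:R) X -> L0_npos (F k%:R) (psi k X);
  phpp_homo : forall k, (k < K)%N ->
    forall X Y, L0 (F k.+1%:R) X -> L0_nneg (F k%:R) Y ->
      psi k (Y \* X) = Y \* psi k X;
  phpp_last : L0_nneg (F K%:R) psiK;
  phpp_last_le1 : forall w, psiK w <= 1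
}.

(* X, with money account A, has the projection property (psi, psiK). *)
Definition has_phpp d (T : measurableType d) (R : realType) (K : nat)
    (psi : nat -> (T -> R) -> (T -> R)) (psiK : T -> R)
    (X : nat -> T -> R) (A : R -> T -> R) : Prop :=
  (forall k, (k < K)%N -> X k = psi k (X k.+1)) /\ X K = psiK \* A K%:R.

(* relative_rate_rev K S psi psiK j is Z_(K - j); the recursion reads
   Z_(k-1) = psi_(k-1)(Z_k S_k) / (S_(k-1) + psi_(k-1)(Z_k S_k)). *)
Fixpoint relative_rate_rev d (T : measurableType d) (R : realType) (K : nat)
    (S : R -> T -> R) (psi : nat -> (T -> R) -> (T -> R)) (psiK : T -> R)
    (j : nat) : T -> R :=
  if j is i.+1 then
    let k := (K - i)%N in
    let Q := psi k.-1 (relative_rate_rev K S psi psiK i \* S k%:R) in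
    fun w => Q w / (S k.-1%:R w + Q w)
  else psiK.

Definition relative_rate d (T : measurableType d) (R : realType) (K : nat)
    (S : R -> T -> R) (psi : nat -> (T -> R) -> (T -> R)) (psiK : T -> R)
    (k : nat) : T -> R :=
  relative_rate_rev K S psi psiK (K - k).

(* Main.v *)
(* By maximality of k0, z_(k+1) > 0 for k >= k0, so that S_(k+1) / S_k is
   Z_(k+1) S_(k+1) scaled by the nonnegative F_k-measurable factor
   1 / (z_(k+1) S_k).  Homogeneity reduces the claim to the value of
   Q = psi_k(Z_(k+1) S_(k+1)), which z_k = Q / (S_k + Q) determines. *)

Require Import Defs.
From HB Require Import structures.
From mathcomp Require Import all_boot all_order all_algebra.
From mathcomp Require Import all_classical all_reals all_analysis.
From mathcomp Require Import measurable_realfun ring.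

Set Implicit Arguments.
Unset Strict Implicit.
Unset Printing Implicit Defensive.

Import Order.TTheory GRing.Theory Num.Theory.

Local Open Scope classical_set_scope.
Local Open Scope ring_scope.

Lemma L0_scale d (T : measurableType d) (R : realType) (G : set (set T))
  (c : R) (f : T -> R) : L0 G f -> L0 G (cst c \* f).
Proof. by move=> mf; apply: measurable_funM => //; exact: measurable_cst. Qed.

(** Inversion is continuous on the open set of nonzero reals, hence measurable there, and [f] takes
    all its values in that set. *)
Lemma L0_inv d (T : measurableType d) (R : realType) (G : set (set T))
  (f : T -> R) : (forall w, f w != 0) -> L0 G f -> L0 G (fun w => (f w)^-1).
Proof.
move=> f_neq0 mf.
apply: (@measurable_comp _ _ _ _ _ _ [set x : R | x != 0] GRing.inv) => //.
- by apply: open_measurable; exact: open_neq.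
- by move=> _ [w _ <-] /=.
- apply: open_continuous_measurable_fun; first exact: open_neq.
  by move=> x /set_mem /= x0; exact: inv_continuous.
Qed.

Theorem proposition3 (d : measure_display) (T : measurableType d)
    (R : realType) (P : probability T R) (K : nat)
    (F : R -> set (set T)) (hF : filtration K F)
    (S : R -> T -> R) (hS : adapted K F S)
    (S_gt0 : forall t : R, 0 <= t <= K%:R -> forall w, 0 < S t w)
    (psi : nat -> (T -> R) -> (T -> R)) (psiK : T -> R)
    (hpsi : phpp K F psi psiK)
    (X : nat -> T -> R) (A : R -> T -> R)
    (hX : consumption_process K F X) (hA : money_account K S X A)
    (Xreg : regular K X A) (Xpsi : has_phpp K psi psiK X A)
    (z : nat -> R)
    (hz : forall k, (k < K)%N -> 0 <= z k < 1) (hzK : 0 <= z K <= 1)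
    (hZ : forall k, (k <= K)%N -> relative_rate K S psi psiK k = cst (z k)) :
  let k0 := (\max_(k < K.+1 | z k == 0%R) k)%N in
  (forall k, (k0 <= k < K)%N ->
     psi k (fun w => S k.+1%:R w / S k%:R w) =
     cst (z k / ((1 - z k) * z k.+1))) /\
  psiK = cst (z K).
Proof.
move=> k0; split; last by rewrite -(hZ _ (leqnn K)) /relative_rate subnn.
move=> k /andP[k0k kK].
have time_in n : (n <= K)%N -> 0 <= (n%:R : R) <= K%:R.
  by move=> nK; rewrite ler0n ler_nat.
have /andP[zk0 zk1] := hz _ kK.
have [tk tk1] := (time_in _ (ltnW kK), time_in _ kK).
(* If [z k.+1] vanished, then [k.+1] would be among the indices of the maximum, giving
   [k.+1 <= k0 <= k]. The sign comes from [hz] or, when [k.+1 = K], from [hzK]. *)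
have zS_gt0 : 0 < z k.+1.
  rewrite lt_neqAle eq_sym; apply/andP; split.
    apply: contraL k0k => zS; rewrite -ltnNge.
    have kK1 : (k.+1 < K.+1)%N by [].
    exact: (@leq_bigmax_cond _ (fun i : 'I_K.+1 => z i == 0)
      (fun i => i : nat) (Ordinal kK1)).
  have := kK; rewrite leq_eqVlt => /orP[/eqP ->|/hz /andP[]//].
  by case/andP: hzK.
have S0 := S_gt0 _ tk.
have zSL0 : L0 (F k.+1%:R) (cst (z k.+1) \* S k.+1%:R).
  by apply: L0_scale; exact: hS.
have Q_ge0 w : 0 <= psi k (cst (z k.+1) \* S k.+1%:R) w.
  suff /(phpp_nneg hpsi kK)[] :
    L0_nneg (F k.+1%:R) (cst (z k.+1) \* S k.+1%:R) by [].
  by split=> // v; rewrite mulr_ge0 // ltW // S_gt0.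
(* Since [K - k] is the successor of [K - k.+1], one unfolding of the reversed recursion exposes the
   time index [K - (K - k.+1) = k.+1], whose predecessor is [k]. *)
have rateE : (fun w => psi k (cst (z k.+1) \* S k.+1%:R) w /
    (S k%:R w + psi k (cst (z k.+1) \* S k.+1%:R) w)) = cst (z k).
  rewrite -(hZ _ (ltnW kK)) -(hZ _ kK) /relative_rate.
  have -> : (K - k = (K - k.+1).+1)%N by rewrite subnSK.
  by rewrite /= subKn.
(* A product of inverses rather than the inverse of a product, so that [L0_scale] and [L0_inv] give
   its measurability. *)
pose Y w := (z k.+1)^-1 * (S k%:R w)^-1.
have -> : (fun w => S k.+1%:R w / S k%:R w) =
    Y \* (cst (z k.+1) \* S k.+1%:R).
  apply/funext => w; rewrite /Y /=.
  by field; rewrite !gt_eqF.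
rewrite (phpp_homo hpsi kK) //; last first.
  split; last by move=> w; rewrite mulr_ge0 ?invr_ge0 ?ltW.
  apply: (@L0_scale _ _ _ _ _ (fun w => (S k%:R w)^-1)).
  by apply: L0_inv => [w|]; [rewrite gt_eqF | exact: hS].
apply/funext => w; rewrite /Y /=.
have := congr1 (@^~ w) rateE; have := Q_ge0 w; have := S0 w.
(* From here the claim is algebra at a fixed [w]: [z k] becomes [q / (s + q)], so [1 - z k] is
   [s / (s + q)], which is nonzero because [s > 0] and [q >= 0]. *)
move: (S k%:R w) (psi k _ w) => s q s_gt0 q_ge0 /= <-.
have sq_gt0 : 0 < s + q by rewrite ltr_pwDl.
by field; rewrite !gt_eqF// addrK.
Qed.
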